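(* For all integers $d\ge1$ and $k\ge2$, \[ L_{\mathrm{pp}}(d,k)\ge d+k-1. \] In particular, $m(d,k)\ge d+k-1$.
   Context: For integers $d\ge1$, $k\ge2$, \[ L_{\mathrm{pp}}(d,k)=\max_{1\le s\le\min(d,\lfloor\log_2k\rfloor)}\left(k-2^s+\left(\left\lfloor\frac ds\right\rfloor+1\right)^{s-(d\bmod s)}\left(\left\lfloor\frac ds\right\rfloor+2\right)^{d\bmod s}\right), \] with $s$ ranging over integers and $d\bmod s$ the remainder on division of $d$ by $s$. A $k$-component Gaussian mixture density on $\mathbb{R}^d$ is a function $\Phi(x)=\sum_{i=1}^k\alpha_i\phi_i(x)$, where $\alpha_i>0$, $\sum_{i=1}^k\alpha_i=1$, and $\phi_i(x)=(2\pi)^{-d/2}\det(\Sigma_i)^{-1/2}\exp\left(-\frac12(x-\mu_i)^\top\Sigma_i^{-1}(x-\mu_i)\right)$ with $\mu_i\in\mathbb{R}^d$ and each $\Sigma_i$ a (symmetric) positive definite $d\times d$ matrix. $\mathrm{Mode}(\Phi)$ is the set of all (not necessarily strict) local maximum points of $\Phi$: $x\in\mathrm{Mode}(\Phi)$ iff there is $\rho>0$ with $\Phi(y)\le\Phi(x)$ whenever $\|y-x\|<\rho$. $m(d,k)$ denotes the supremum of $|\mathrm{Mode}(\Phi)|$ over all $k$-component Gaussian mixture densities $\Phi$ on $\mathbb{R}^d$ for which $\mathrm{Mode}(\Phi)$ is finite. *)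

(* Defs.v *)
From mathcomp Require Import all_boot all_order all_algebra finmap.
From mathcomp Require Import boolp classical_sets functions cardinality.
From mathcomp Require Import reals ereal sequences exp trigo.

Set Implicit Arguments.
Unset Strict Implicit.
Unset Printing Implicit Defensive.

Import Order.TTheory GRing.Theory Num.Theory.

Local Open Scope classical_set_scope.
Local Open Scope ring_scope.

(* [trunc_log 2 k] is the floor of the base-2 logarithm of [k].
   On the range of [s] we have [2 ^ s <= k] and [d %% s < s], so the natural
   number subtractions do not truncate; for [1 <= d] and [2 <= k] the range
   contains [s = 1], so the default value 0 of [\max] plays no role. *)
Definition Lpp (d k : nat) : nat :=
  (\max_(1 <= s < (minn d (trunc_log 2 k)).+1)
     (k - 2 ^ s
      + (d %/ s + 1) ^ (s - d %% s) * (d %/ s + 2) ^ (d %% s)))%N.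

Section GaussianMixtures.
Context {R : realType}.

(* The norm that mathcomp-analysis puts on matrices is the sup norm. *)
Definition eucl_norm (d : nat) (x : 'cV[R]_d) : R :=
  Num.sqrt (\sum_(i < d) x i 0 ^+ 2).

Definition posdefmx (d : nat) (S : 'M[R]_d) : Prop :=
  S^T = S /\ forall v : 'cV[R]_d, v != 0 -> 0 < (v^T *m S *m v) 0 0.

Definition gaussian_density (d : nat) (mu : 'cV[R]_d) (S : 'M[R]_d)
    (x : 'cV[R]_d) : R :=
  (2 * pi) `^ (- (d%:R / 2)) * (\det S) `^ (- (1 / 2))
  * expR (- (1 / 2) * ((x - mu)^T *m invmx S *m (x - mu)) 0 0).

Definition gaussian_mixture (d k : nat) (Phi : 'cV[R]_d -> R) : Prop :=
  exists (alpha : 'I_k -> R) (mu : 'I_k -> 'cV[R]_d) (S : 'I_k -> 'M[R]_d),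
    [/\ forall i, 0 < alpha i,
        \sum_(i < k) alpha i = 1,
        forall i, posdefmx (S i)
      & forall x, Phi x = \sum_(i < k) alpha i * gaussian_density (mu i) (S i) x].

Definition Mode (d : nat) (Phi : 'cV[R]_d -> R) : set 'cV[R]_d :=
  [set x | exists2 rho : R, 0 < rho &
             forall y, eucl_norm (y - x) < rho -> Phi y <= Phi x].

End GaussianMixtures.

(* The supremum is taken in the extended reals, as it is not known a priori to
   be finite; [fset_set A] is the finite set with the elements of [A] when [A]
   is finite. *)
Definition max_modes (R : realType) (d k : nat) : \bar R :=
  ereal_sup [set (#|` fset_set (Mode Phi)|%fset%:R)%:E |
              Phi in [set Phi : 'cV[R]_d -> R |
                       gaussian_mixture k Phi /\ finite_set (Mode Phi)]].

(* Main.v *)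
Require Import Defs.
From mathcomp Require Import all_boot all_order all_algebra finmap.
From mathcomp Require Import boolp classical_sets functions cardinality.
From mathcomp Require Import reals ereal topology normedtype sequences derive.
From mathcomp Require Import realfun exp trigo.
From mathcomp Require Import ring lra zify.

(** The bound on [Lpp] is the term of index [s = 1], which equals
    [k - 2 + (d + 1)].

    The bound on the number of modes comes from an explicit mixture, proportional
    to one wide component [Q] and [k - 1] narrow components [P_0, P_1, ...].  Each
    [P_i] has precision matrix [p I]; its centre is [(- 2 B i, 0, ..., 0)], with
    [B] huge.  [Q] is centred at [(1, ..., 1)] and has the diagonal precisions
    [q_j = p / th ^ j], where [th = exp (p / 2)].

    Many modes.  Let [lambda] be the logarithm of the odds [Q / P_0].  Since the
    ratios [q_j / p] decrease very fast, coordinate [j] moves from the centre of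
    [P_0] to that of [Q] when [lambda] crosses [j p / 2], so that the components
    [P_0] and [Q] alone create [d + 1] modes, one for each of the corners
    [(1, ..., 1, 0, ..., 0)].  To prove it, the density on a level set
    [lambda = c p / 2] is bounded by writing its logarithm as a convex combination
    of the two concave quadratics [log P_0] and [log Q] ([level_le]); this is less
    than the values at the two neighbouring corners ([corner_above_left],
    [corner_above_right]).  Hence each slab between consecutive levels contains a
    local maximum, and these are [d + 1] modes ([mode_corner]).  Each of the
    other [k - 2] narrow components is so far away that it adds one mode of its
    own ([mode_spike]).

    Finitely many modes.  The narrow components differ only in the first
    coordinate of their centres, and there [P_i] and [Q] have the same precision
    [p].  Therefore, at a critical point with first coordinate [y], the odds of
    [Q] against all the narrow components together are an explicit function of
    [y], rational in [y] and [exp (b y)], and so are the other coordinates.  What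
    remains is one equation in [y] ([mode_param]), whose derivative is again
    rational in [y] and [exp (b y)].  A nonzero exponential polynomial has finitely
    many zeros, by Rolle's theorem and induction ([finite_zeros_expsum]), and the
    derivative is not identically zero because the equation blows up at [y = 1]
    ([mode_eq_blowup]); a last use of Rolle's theorem gives [finite_modes]. *)

Set Implicit Arguments.
Unset Strict Implicit.
Unset Printing Implicit Defensive.

Import Order.TTheory GRing.Theory Num.Theory.
Import numFieldNormedType.Exports.

Local Open Scope classical_set_scope.
Local Open Scope ring_scope.

(** * Rolle's theorem and zeros of exponential polynomials *)

Section Rolle.
Context {R : realType}.
Implicit Types (A B X : set R) (f : R -> R).

Lemma count_ltn (T : eqType) (p q : pred T) (s : seq T) x :
  subpred p q -> x \in s -> q x -> ~~ p x -> (count p s < count q s)%N.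
Proof.
move=> pq + qx npx; elim: s => //= z s IH; rewrite in_cons => /orP[/eqP<-|xs].
  by rewrite qx (negbTE npx) add0n add1n ltnS; exact: sub_count.
rewrite -addnS leq_add ?IH //; case: (boolP (p z)) => // /pq -> //.
Qed.

(** The number of points of [B] below [a] is a bounded and strictly increasing
    function of [a] in [A]. *)
Lemma finite_separated A B : finite_set B ->
  (forall a b, A a -> A b -> a < b -> exists2 c, B c & a < c < b) ->
  finite_set A.
Proof.
move=> /finite_seqP[s Bs] sep.
pose rank a := count (fun c => c < a) s.
have rank_lt a b : A a -> A b -> a < b -> (rank a < rank b)%N.
  move=> Aa Ab ab; have [c Bc /andP[ac cb]] := sep _ _ Aa Ab ab.
  have cs : c \in s by rewrite Bs in Bc.
  apply: count_ltn cs cb _; last by rewrite -leNgt ltW.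
  by move=> z /= za; exact: lt_trans za ab.
have inj : {in A &, injective rank}.
  move=> a b; rewrite !inE => Aa Ab E.
  case: (ltgtP a b) => // [/(rank_lt _ _ Aa Ab)|/(rank_lt _ _ Ab Aa)];
  by rewrite E ltnn.
rewrite -(eq_finite_set (inj_card_eq inj)).
apply: sub_finite_set (finite_II (size s).+1) => _ [a _ <-].
by rewrite /= ltnS count_size.
Qed.

(** The set [X] collects the points where [f] may fail to be differentiable:
    between two zeros of [f] outside [X] there is a point of [X] or, by Rolle's
    theorem, a zero of [f']. *)
Lemma finite_zeros_derive X f f' : finite_set X ->
  (forall y, ~ X y -> is_derive y 1 f (f' y)) ->
  finite_set [set y | ~ X y /\ f' y = 0] -> finite_set [set y | f y = 0].
Proof.
move=> fX df fZ.
have sub : [set y | f y = 0] `<=` X `|` [set y | ~ X y /\ f y = 0].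
  by move=> y fy; have [|] := pselect (X y); [left|right].
apply: sub_finite_set sub _; rewrite finite_setU; split => //.
apply: (@finite_separated _ (X `|` [set y | ~ X y /\ f' y = 0])).
  by rewrite finite_setU.
move=> a b [Xa fa] [Xb fb] ab.
have [[c [Xc acb]]|noX] := pselect (exists c, X c /\ a < c < b).
  by exists c => //; left.
have drv c : c \in `[a, b] -> is_derive c 1 f (f' c).
  rewrite in_itv /= => /andP[ac cb]; apply: df => Xc; apply: noX; exists c.
  split=> //; rewrite !lt_neqAle ac cb !andbT; apply/andP; split.
    by apply/eqP => E; apply: Xa; rewrite E.
  by apply/eqP => E; apply: Xb; rewrite -E.
have drv' c : c \in `]a, b[ -> derivable f c 1.
  by move=> /subset_itv_oo_cc /drv ?; exact: ex_derive.
have [|c acb dc] := Rolle ab drv' _ (etrans fa (esym fb)).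
  apply: derivable_within_continuous => c /drv ?; exact: ex_derive.
have dc' := drv _ (subset_itv_oo_cc acb).
have fc0 : f' c = 0 by rewrite -(@derive_val _ _ _ _ _ _ _ dc') (@derive_val _ _ _ _ _ _ _ dc).
exists c; last by rewrite in_itv in acb.
right; split=> // Xc; apply: noX; exists c; split=> //; by rewrite in_itv in acb.
Qed.
End Rolle.

Section ExpPoly.
Context {R : realType} (b : R) (b0 : b != 0).

Lemma is_derive_expRM i (y : R) : is_derive y (1 : R)
  (fun y => expR (b * y) ^+ i) (i%:R * b * expR (b * y) ^+ i).
Proof.
have -> : (fun y => expR (b * y) ^+ i) = expR \o (fun z => (i%:R * b) * z).
  by apply/funext => z /=; rewrite -expRM_natl mulrA.
rewrite -expRM_natl [X in is_derive _ _ _ X]mulrC mulrA.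
have h : is_derive y (1:R) (fun z => (i%:R * b) * z) (i%:R * b).
  apply: (@is_derive_eq _ _ _ _ _ _ _ _ (is_deriveZ (i%:R * b) (is_derive_id y (1:R)))).
  by rewrite /GRing.scale /= mulr1.
exact: (is_derive1_comp (is_derive_expR _) h).
Qed.

Lemma is_derive_expsum n (a : nat -> {poly R}) (y : R) :
  is_derive y (1 : R) (fun y => \sum_(i < n) (a i).[y] * expR (b * y) ^+ i)
   (\sum_(i < n) ((a i)^`() + (i%:R * b) *: a i).[y] * expR (b * y) ^+ i).
Proof.
rewrite (_ : (fun _ => _) =
  \sum_(i < n) (fun y => (a i).[y] * expR (b * y) ^+ i)); last first.
  by apply/funext => z; rewrite fct_sumE.
apply: is_derive_eq.
  apply: is_derive_sum => i.
  apply: (is_deriveM (is_derive_poly _ _) (is_derive_expRM i y)).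
apply: eq_bigr => i _.
by rewrite hornerD hornerZ /GRing.scale /=; ring.
Qed.

Lemma finite_roots (p : {poly R}) : p != 0 -> finite_set [set y | p.[y] = 0].
Proof.
move=> p0; apply: contrapT => /(@infinite_set_fset _ _ (size p))[C Cp szC].
have /max_poly_roots : all (root p) (C : seq R).
  by apply/allP => y yC; apply/eqP/Cp.
by move=> /(_ p0 (fset_uniq C)); rewrite ltnNge szC.
Qed.

(** Differentiation lowers the degree of the coefficient of [exp (0 y)] and keeps
    the other coefficients nonzero, so that Rolle's theorem applies until the
    former vanishes; then [exp (b y)] can be factored out, which leaves fewer
    exponentials. *)
Lemma finite_zeros_expsum n (a : nat -> {poly R}) :
  (exists2 i, (i < n)%N & a i != 0) ->
  finite_set [set y : R | \sum_(i < n) (a i).[y] * expR (b * y) ^+ i = 0].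
Proof.
elim: n a => [a [i]//|n IHn a ex_a].
pose a' i := a i.+1.
have [a'0|na'0] := pselect (exists2 i, (i < n)%N & a' i != 0); last first.
  have a'0 i : (i < n)%N -> a' i = 0.
    by move=> lin; apply/eqP; apply: contra_notT na'0 => ?; exists i.
  have a0 : a 0 != 0.
    by case: ex_a => -[//|i] lin; rewrite -/(a' i) a'0 ?eqxx.
  apply: sub_finite_set (finite_roots a0) => y /=.
  rewrite big_ord_recl /= expr0 mulr1 big1 ?addr0 // => i _.
  by rewrite -/(a' i) a'0 // horner0 mul0r.
(* Inner induction, on the degree of the coefficient of [exp (0 y)]. *)
move: (leqnn (size (a 0%N))); move: {2}(size _) => m.
rewrite {}/a' {ex_a} in a'0 *; elim: m a a'0 => [|m IHm] a a'0 sza;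
  pose a' i := a i.+1.
  move: sza; rewrite leqn0 size_poly_eq0 => /eqP a0.
  apply: sub_finite_set (IHn a' a'0) => y /=.
  rewrite big_ord_recl /= a0 horner0 mul0r add0r.
  rewrite (eq_bigr (fun i : 'I_n => expR (b * y) * ((a' i).[y] * expR (b * y) ^+ i))).
    by rewrite -big_distrr /= => /eqP; rewrite mulf_eq0 expR_eq0 => /eqP.
  by move=> i _; rewrite /= exprS mulrCA.
apply: (@finite_zeros_derive _ set0 _ _ (finite_set0 _)).
  by move=> y _; exact: is_derive_expsum.
pose D i := (a i)^`() + (i%:R * b) *: a i.
apply: (@sub_finite_set _ _ [set y | \sum_(i < n.+1) (D i).[y] * expR (b * y) ^+ i = 0]).
  by move=> y [].
apply: IHm.
  case: a'0 => i lin ai0; exists i => //.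
  have ci : i.+1%:R * b != 0 by rewrite mulf_neq0 // pnatr_eq0.
  have ltsz : (size (a' i)^`() < size (i.+1%:R * b *: a' i)%R)%N.
    by rewrite size_scale // lt_size_deriv.
  by rewrite -size_poly_eq0 /D addrC size_polyDl // size_scale // size_poly_eq0.
rewrite /D mul0r scale0r addr0.
have [->|a0] := eqVneq (a 0%N) 0; first by rewrite deriv0 size_poly0.
by rewrite -ltnS; apply: leq_trans sza; exact: lt_size_deriv.
Qed.

(** * Functions rational in y and exp (b y) *)

Definition exp_eval (P : {poly {poly R}}) (y : R) : R := P.[(expR (b * y))%:P].[y].

Lemma exp_evalE P y :
  exp_eval P y = \sum_(i < size P) (P`_i).[y] * expR (b * y) ^+ i.
Proof.
rewrite /exp_eval (horner_coef P) horner_sum; apply: eq_bigr => i _.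
by rewrite hornerM -polyC_exp hornerC.
Qed.

Lemma exp_evalD P Q y : exp_eval (P + Q) y = exp_eval P y + exp_eval Q y.
Proof. by rewrite /exp_eval !hornerD. Qed.

Lemma exp_evalM P Q y : exp_eval (P * Q) y = exp_eval P y * exp_eval Q y.
Proof. by rewrite /exp_eval !hornerM. Qed.

Lemma finite_zeros_exp_eval P : P != 0 -> finite_set [set y | exp_eval P y = 0].
Proof.
move=> P0; rewrite (_ : [set y | _] =
  [set y | \sum_(i < size P) (P`_i).[y] * expR (b * y) ^+ i = 0]).
  apply: finite_zeros_expsum; exists (size P).-1.
    by rewrite ltn_predL size_poly_gt0.
  by rewrite -lead_coefE lead_coef_eq0.
by apply/seteqP; split=> y /=; rewrite exp_evalE.
Qed.

Lemma is_derive_exp_eval P : exists dP, forall y : R,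
  is_derive y (1 : R) (exp_eval P) (exp_eval dP y).
Proof.
exists (\poly_(i < size P) ((P`_i)^`() + (i%:R * b) *: P`_i)) => y.
rewrite (_ : exp_eval P =
   fun y => \sum_(i < size P) (P`_i).[y] * expR (b * y) ^+ i); last first.
  by apply/funext => z; rewrite exp_evalE.
apply: is_derive_eq; first exact: is_derive_expsum.
rewrite /exp_eval horner_poly horner_sum; apply: eq_bigr => i _.
by rewrite [in RHS]hornerM -polyC_exp hornerC.
Qed.

(** As [Q] is allowed to vanish at finitely many points, where [h] is arbitrary,
    tame functions form a field up to equality off a finite set; they are closed
    under the total inverse with [0^-1 = 0]. *)
Definition tame (h : R -> R) := exists P Q : {poly {poly R}},
  Q != 0 /\ forall y, exp_eval Q y != 0 -> h y = exp_eval P y / exp_eval Q y.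

Lemma tame_cst c : tame (fun=> c).
Proof.
exists c%:P%:P, 1; split; first exact: oner_neq0.
by move=> y _; rewrite /exp_eval !hornerC divr1.
Qed.

Lemma tame_id : tame id.
Proof.
exists 'X%:P, 1; split; first exact: oner_neq0.
by move=> y _; rewrite /exp_eval !(hornerC,hornerX) divr1.
Qed.

Lemma tame_exp : tame (fun y => expR (b * y)).
Proof.
exists 'X, 1; split; first exact: oner_neq0.
by move=> y _; rewrite /exp_eval !(hornerC,hornerX) divr1.
Qed.

Lemma tameD f g : tame f -> tame g -> tame (fun y => f y + g y).
Proof.
move=> [P [Q [Q0 fE]]] [P' [Q' [Q'0 gE]]].
exists (P * Q' + P' * Q), (Q * Q'); split; first by rewrite mulf_neq0.
move=> y; rewrite exp_evalD !exp_evalM mulf_eq0 negb_or => /andP[q q'].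
by rewrite fE // gE //; field; apply/andP.
Qed.

Lemma tameM f g : tame f -> tame g -> tame (fun y => f y * g y).
Proof.
move=> [P [Q [Q0 fE]]] [P' [Q' [Q'0 gE]]].
exists (P * P'), (Q * Q'); split; first by rewrite mulf_neq0.
move=> y; rewrite !exp_evalM mulf_eq0 negb_or => /andP[q q'].
by rewrite fE // gE //; field; apply/andP.
Qed.

Lemma tameV f : tame f -> tame (fun y => (f y)^-1).
Proof.
move=> [P [Q [Q0 fE]]]; have [P0|P0] := eqVneq P 0.
  exists 0, Q; split => // y q.
  by rewrite fE // P0 /exp_eval !horner0 !mul0r invr0.
exists (Q * Q), (P * Q); split; first by rewrite mulf_neq0.
move=> y; rewrite !exp_evalM mulf_eq0 negb_or => /andP[p q].
by rewrite fE //; field; apply/andP.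
Qed.

Lemma tameN f : tame f -> tame (fun y => - f y).
Proof.
move=> /(tameM (tame_cst (-1))); congr tame.
by apply/funext => y; rewrite mulN1r.
Qed.

Lemma tameB f g : tame f -> tame g -> tame (fun y => f y - g y).
Proof. by move=> tf tg; apply: tameD tf (tameN tg). Qed.

Lemma tameX f n : tame f -> tame (fun y => f y ^+ n).
Proof.
move=> tf; elim: n => [|n IHn]; first exact: tame_cst.
have := tameM tf IHn; congr tame.
by apply/funext => y; rewrite exprS.
Qed.

Lemma tame_sum n (f : 'I_n -> R -> R) : (forall i, tame (f i)) ->
  tame (fun y => \sum_(i < n) f i y).
Proof.
elim: n f => [f _|n IHn f tf].
  by rewrite (_ : (fun=> _) = (fun=> 0)); [exact: tame_cst|
    apply/funext => y; rewrite big_ord0].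
rewrite (_ : (fun y => _) = (fun y => \sum_(i < n) f (widen_ord (leqnSn n) i) y
   + f ord_max y)).
  by apply: tameD => //; apply: IHn.
by apply/funext => y; rewrite big_ord_recr.
Qed.

Lemma tame_zeros h : tame h ->
  finite_set [set y | h y != 0] \/ finite_set [set y | h y = 0].
Proof.
move=> [P [Q [Q0 hE]]]; have fQ := finite_zeros_exp_eval Q0.
have [P0|P0] := eqVneq P 0.
  left; apply: sub_finite_set fQ => y /= hy; apply/eqP; apply: contraNT hy => q.
  by rewrite hE // P0 /exp_eval !horner0 mul0r.
right; have fP := finite_zeros_exp_eval P0.
apply: (@sub_finite_set _ _
  ([set y | exp_eval P y = 0] `|` [set y | exp_eval Q y = 0])); last first.
  by rewrite finite_setU.
move=> y /= hy; have [q|q] := eqVneq (exp_eval Q y) 0; [by right|left].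
by move/eqP: hy; rewrite hE // mulf_eq0 invr_eq0 (negbTE q) orbF => /eqP.
Qed.

(** This class contains the tame functions, and the logarithms of their absolute
    values when they have finitely many zeros; Rolle's theorem reduces its zeros to those of a tame function. *)
Definition tame_derive (f : R -> R) := exists X h, [/\ finite_set X, tame h &
  forall y : R, ~ X y -> is_derive y (1 : R) f (h y)].

Lemma tame_tame_derive f : tame f -> tame_derive f.
Proof.
move=> [P [Q [Q0 fE]]]; have fQ := finite_zeros_exp_eval Q0.
have [dP dPE] := is_derive_exp_eval P; have [dQ dQE] := is_derive_exp_eval Q.
exists [set y | exp_eval Q y = 0],
  (fun y => (exp_eval dP y * exp_eval Q y - exp_eval P y * exp_eval dQ y) /
     exp_eval Q y ^+ 2); split => //.
- have tP A : tame (exp_eval A).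
    exists A, 1; split; first exact: oner_neq0.
    by move=> y _; rewrite {3}/exp_eval !hornerC divr1.
  by apply: tameM; [apply: tameB; apply: tameM|apply/tameV/tameX].
move=> y /= /eqP q.
apply: (@near_eq_is_derive _ _ _ (exp_eval P * (fun y => (exp_eval Q y)^-1))) => //.
  have cQ : {for y, continuous (exp_eval Q)}.
    apply/differentiable_continuous/derivable1_diffP.
    exact: (@ex_derive _ _ _ _ _ _ _ (dQE y)).
  near=> z; rewrite fE; first by [].
  near: z; exact: (cvgr_neq0 _ cQ q).
apply: (is_derive_eq (is_deriveM (dPE y) (is_deriveV q (dQE y)))).
by rewrite /GRing.scale /=; field.
Unshelve. all: by end_near. Qed.

Lemma tame_deriveD f g : tame_derive f -> tame_derive g ->
  tame_derive (fun y => f y + g y).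
Proof.
move=> [X [h [fX th df]]] [Y [k [fY tk dg]]].
exists (X `|` Y), (fun y => h y + k y); split; first by rewrite finite_setU.
  exact: tameD.
by move=> y /not_orP[/df ? /dg ?]; exact: is_deriveD.
Qed.

(** The square makes the logarithm meaningful for both signs of [f]. *)
Lemma tame_derive_ln f : tame f -> (exists2 X, finite_set X & forall y, ~ X y -> f y != 0) ->
  tame_derive (fun y => ln (f y ^+ 2) / 2).
Proof.
move=> tf [Y fY f0]; have [X [h [fX th df]]] := tame_tame_derive tf.
exists (X `|` Y), (fun y => h y / f y); split; first by rewrite finite_setU.
  by apply: tameM => //; exact: tameV.
move=> y /not_orP[/df dfy /f0 fy0].
have f2 : 0 < f y ^+ 2 by rewrite exprn_even_gt0.
have d2 : is_derive y (1 : R) (fun z => f z ^+ 2) (h y * f y *+ 2).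
  have := is_deriveX 2 dfy; rewrite exprfctE => d; apply: (is_derive_eq d).
  by rewrite /GRing.scale /=; ring.
have := is_deriveZ 2^-1
  (@is_derive1_comp _ (@ln R) (fun z => f z ^+ 2) y _ _ (is_derive1_ln f2) d2).
rewrite (_ : 2^-1 \*: _ = (fun z => ln (f z ^+ 2) / 2)); last first.
  by apply/funext => z; rewrite /= /GRing.scale /= mulrC.
by move=> d; apply: (is_derive_eq d); rewrite /GRing.scale /=; field.
Qed.

Lemma finite_left_gap (X : set R) a : finite_set X ->
  exists2 t, t < a & forall y, t < y < a -> ~ X y.
Proof.
move=> /finite_seqP[s ->]; elim: s => [|x s [t ta IH]].
  by exists (a - 1); rewrite ?ltrBlDr ?ltrDl.
have [ax|xa] := leP a x.
  exists t => // y tya; rewrite /= in_cons => /orP[/eqP yx|]; last exact: IH.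
  by move: tya; rewrite yx [x < a]ltNge ax andbF.
exists (Num.max t x); first by rewrite gt_max ta xa.
move=> y /andP[]; rewrite gt_max => /andP[ty xy] ya.
rewrite /= in_cons => /orP[/eqP yx|]; first by rewrite yx ltxx in xy.
by apply: IH; rewrite ty ya.
Qed.

(** The derivative of [f] has finitely many zeros unless it vanishes off a finite
    set; in that case [f] would be constant on some interval [(t, a)], against its
    growth at [a]. *)
Lemma finite_zeros_tame_derive f a : tame_derive f ->
  (forall M, exists2 t, t < a & forall y, t < y < a -> M < f y) ->
  finite_set [set y | f y = 0].
Proof.
move=> [X [h [fX th df]]] fy.
have [fh|fh] := tame_zeros th; last first.
  apply: (finite_zeros_derive fX df).
  by apply: sub_finite_set fh => y [].
have fXh : finite_set (X `|` [set y | h y != 0]) by rewrite finite_setU.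
have [t ta gap] := finite_left_gap a fXh.
pose y1 := (t + a) / 2; have [t' t'a ft'] := fy (f y1).
pose y2 := (Num.max t' y1 + a) / 2.
have ty1 : t < y1 < a by rewrite /y1; lra.
have /andP[t'm y1m] : (t' <= Num.max t' y1) && (y1 <= Num.max t' y1).
  by rewrite !le_max !lexx orbT.
have ma : Num.max t' y1 < a by rewrite gt_max t'a; case/andP: ty1.
have y12 : y1 < y2 by rewrite /y2; lra.
have y2a : y2 < a by rewrite /y2; lra.
have f12 : f y1 < f y2 by apply: ft'; rewrite y2a andbT /y2; lra.
have gap' c : c \in `[y1, y2] -> is_derive c 1 f 0.
  rewrite in_itv /= => /andP[y1c cy2].
  have : ~ (X `|` [set y | h y != 0]) c by apply: gap; lra.
  move=> /not_orP[/df + /negP]; rewrite negbK => + /eqP hc.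
  by rewrite hc.
have dz c : c \in `]y1, y2[ -> is_derive c 1 f ((fun=> 0 : R) c).
  by move=> /subset_itv_oo_cc; exact: gap'.
have cz : {within `[y1, y2], continuous f}.
  by apply: derivable_within_continuous => c /gap' ?; exact: ex_derive.
have [c _] := MVT_segment (ltW y12) dz cz.
by rewrite mul0r => /eqP; rewrite subr_eq0 gt_eqF.
Qed.

End ExpPoly.

(** * Mixtures with diagonal covariances and their modes *)

Section Bumps.
Context {R : realType}.

(** The parameters are the diagonal precisions [p] and the centre [m].  Leaving out
    the normalization constant makes the values at the centres equal to 1. *)
Definition bump d (p m : 'I_d -> R) (x : 'cV[R]_d) : R :=
  expR (- (1 / 2) * \sum_j p j * (x j 0 - m j) ^+ 2).

Definition bumps n d (a : 'I_n -> R) (p m : 'I_n -> 'I_d -> R) (x : 'cV[R]_d) : R :=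
  \sum_i a i * bump (p i) (m i) x.

Lemma quad_diag d (r : 'I_d -> R) (v : 'cV[R]_d) :
  (v^T *m diag_mx (\row_j r j) *m v) 0 0 = \sum_j r j * v j 0 ^+ 2.
Proof.
rewrite mxE; apply: eq_bigr => j _.
by rewrite mul_mx_diag !mxE; ring.
Qed.

Lemma posdef_diag d (r : 'I_d -> R) : (forall j, 0 < r j) ->
  posdefmx (diag_mx (\row_j r j)).
Proof.
move=> r0; split; first by rewrite tr_diag_mx.
move=> v v0; rewrite quad_diag.
have [j vj] : exists j, v j 0 != 0.
  apply/existsP; apply: contraNT v0; rewrite negb_exists => /forallP v0.
  by apply/eqP/colP => j; rewrite mxE; apply/eqP; have := v0 j; rewrite negbK.
rewrite (bigD1 j) //= ltr_pwDl //.
  by rewrite mulr_gt0 // exprn_even_gt0.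
by apply: sumr_ge0 => i _; rewrite mulr_ge0 ?sqr_ge0 // ltW.
Qed.

Lemma gaussian_density_diag d (p m : 'I_d -> R) : (forall j, 0 < p j) ->
  exists2 K : R, 0 < K & forall x,
   gaussian_density (\col_j m j) (diag_mx (\row_j (p j)^-1)) x = K * bump p m x.
Proof.
move=> p0; set S := diag_mx _.
exists ((2 * pi) `^ (- (d%:R / 2)) * (\det S) `^ (- (1 / 2))).
  apply: mulr_gt0; apply: powR_gt0; first by rewrite mulr_gt0 ?pi_gt0.
  by rewrite det_diag; apply: prodr_gt0 => j _; rewrite mxE invr_gt0.
have SD : S *m diag_mx (\row_j p j) = 1%:M.
  by rewrite mulmx_diag; apply/matrixP => i j; rewrite !mxE mulVf // lt0r_neq0.
have [Su _] := mulmx1_unit SD.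
have iS : invmx S = diag_mx (\row_j p j).
  by rewrite -[LHS]mulmx1 -SD mulmxA mulVmx // mul1mx.
move=> x; rewrite /gaussian_density iS quad_diag; congr (_ * expR (_ * _)).
by apply: eq_bigr => j _; rewrite !mxE.
Qed.

(** The weights absorb the normalization constants, and [c] makes them sum to 1. *)
Lemma bumps_mixture n d (a : 'I_n.+1 -> R) (p m : 'I_n.+1 -> 'I_d -> R) :
  (forall i, 0 < a i) -> (forall i j, 0 < p i j) ->
  exists2 c : R, 0 < c & gaussian_mixture n.+1 (fun x => c * bumps a p m x).
Proof.
move=> a0 p0.
have /choice[K HK] i : exists K, 0 < K /\ forall x,
    gaussian_density (\col_j m i j) (diag_mx (\row_j (p i j)^-1)) x = K * bump (p i) (m i) x.
  by have [K ? ?] := gaussian_density_diag (m i) (p0 i); exists K.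
have K0 i : 0 < K i by case: (HK i).
have s0 : 0 < \sum_i a i / K i.
  rewrite big_ord_recl ltr_pwDl ?divr_gt0 //.
  by apply: sumr_ge0 => i _; rewrite divr_ge0 // ltW.
exists (\sum_i a i / K i)^-1; first by rewrite invr_gt0.
exists (fun i => (\sum_i a i / K i)^-1 * (a i / K i)), (fun i => \col_j m i j),
  (fun i => diag_mx (\row_j (p i j)^-1)); split.
- by move=> i; rewrite mulr_gt0 ?invr_gt0 // divr_gt0.
- by rewrite -big_distrr /= mulVf // gt_eqF.
- by move=> i; apply: posdef_diag => j; rewrite invr_gt0.
move=> x; rewrite /bumps big_distrr /=; apply: eq_bigr => i _.
have [_ ->] := HK i.
by rewrite -!mulrA mulKf // gt_eqF.
Qed.

Lemma Mode_scale d (F : 'cV[R]_d -> R) (c : R) : 0 < c ->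
  Mode (fun x => c * F x) = Mode F.
Proof.
move=> c0; apply/seteqP; split=> x [rho r0 H]; exists rho => // y /H;
by rewrite ler_pM2l.
Qed.

(** The partial derivatives vanish at a local maximum; the factor [- 1] is dropped. *)
Lemma bumps_critical n d (a : 'I_n -> R) (p m : 'I_n -> 'I_d -> R) x j :
  Mode (bumps a p m) x ->
  \sum_i a i * bump (p i) (m i) x * (p i j * (x j 0 - m i j)) = 0.
Proof.
move=> [rho r0 maxF].
pose l t : 'cV[R]_d := x + t *: delta_mx j 0.
pose f t := bumps a p m (l t).
have lE t i : l t i 0 = x i 0 + (i == j)%:R * t.
  by rewrite !mxE eqxx andbT mulrC.
(* Along the line through [x] in direction [j], component [i] is the exponential
   of the quadratic polynomial [g i]. *)
pose s i := \sum_(i' | i' != j) p i i' * (x i' 0 - m i i') ^+ 2.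
pose g i : {poly R} := (- (1 / 2))%:P * (p i j *: ('X + (x j 0 - m i j)%:P) ^+ 2 + (s i)%:P).
have bE i t : bump (p i) (m i) (l t) = expR (g i).[t].
  rewrite /bump /g hornerM hornerD hornerZ horner_exp hornerD hornerX !hornerC.
  congr expR; congr (_ * _).
  rewrite (bigD1 j) //= lE eqxx mul1r; congr (_ * _ ^+ 2 + _); first by ring.
  by apply: eq_bigr => i' /negbTE i'j; rewrite lE i'j mul0r addr0.
have df t : is_derive t (1 : R) f (\sum_i a i * (expR (g i).[t] * (g i)^`().[t])).
  rewrite (_ : f = \sum_i (fun t => a i * (expR \o horner (g i)) t)); last first.
    by apply/funext => u; rewrite fct_sumE; apply: eq_bigr => i _; rewrite bE.
  exact: is_derive_sum.
have n0 : (0 : R) \in `](- rho), rho[ by rewrite in_itv /= oppr_lt0 r0.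
have l0 : l 0 = x by rewrite /l scale0r addr0.
have dmax : is_derive (0 : R) (1 : R) f 0.
  apply: (@derive1_at_max _ f (- rho) rho 0 _ _ n0).
  - by rewrite ge0_cp // ltW.
  - by move=> t _; exact: (@ex_derive _ _ _ _ _ _ _ (df t)).
  move=> t; rewrite in_itv /= => tr; rewrite /f l0; apply: maxF.
  rewrite /l addrAC subrr add0r /eucl_norm (bigD1 j) //= big1 => [|i ij].
    by rewrite addr0 !mxE !eqxx mulr1 sqrtr_sqr ltr_norml.
  by rewrite !mxE (negbTE ij) mulr0 expr0n.
have := @derive_val _ _ _ _ _ _ _ (df 0).
rewrite (@derive_val _ _ _ _ _ _ _ dmax) => /esym E.
apply/eqP; rewrite -oppr_eq0 -sumrN; apply/eqP; rewrite -[RHS]E; apply: eq_bigr => i _.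
rewrite -bE l0 /g derivM derivC mul0r add0r derivD derivC addr0 derivZ expr2.
rewrite derivM derivD derivX derivC addr0 !mul1r !mulr1.
rewrite hornerM hornerC hornerZ !(hornerD,hornerX,hornerC).
by field.
Qed.

Lemma continuous_scaleR (T : topologicalType) (c : R) (g : T -> R) :
  continuous g -> continuous (fun x => c * g x).
Proof. by move=> cg x; exact: (continuousM (@cvg_cst _ c T (nbhs x) _) (cg x)). Qed.

Lemma continuous_sumR (T : topologicalType) n (f : 'I_n -> T -> R) :
  (forall i, continuous (f i)) -> continuous (fun x => \sum_i f i x).
Proof. by move=> cf; apply: continuous_big => //; exact: add_continuous. Qed.

Lemma quad_continuous d (p m : 'I_d -> R) :
  continuous (fun y : 'cV[R]_d => \sum_j p j * (y j 0 - m j) ^+ 2).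
Proof.
apply: continuous_sumR => j; apply: continuous_scaleR => x.
have cj : {for x, continuous (fun y : 'cV[R]_d => y j 0 - m j)}.
  exact: (continuousB (@coord_continuous _ _ _ j 0 x) (@cvg_cst _ (m j) _ (nbhs x) _)).
exact: (continuous_comp cj (@exprn_continuous _ 2 _)).
Qed.

Lemma bump_continuous d (p m : 'I_d -> R) : continuous (bump p m).
Proof.
move=> x; have c := @continuous_scaleR _ (- (1 / 2)) _ (@quad_continuous d p m).
exact: (continuous_comp (c x) (@continuous_expR _ _)).
Qed.

Lemma bumps_continuous n d (a : 'I_n -> R) (p m : 'I_n -> 'I_d -> R) :
  continuous (bumps a p m).
Proof.
by apply: continuous_sumR => i; apply: continuous_scaleR; exact: bump_continuous.
Qed.

Lemma expR_small (e : R) : 0 < e -> exists2 B, 0 < B & forall s, B <= s -> expR (- s) < e.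
Proof.
move=> e0; exists (e^-1); first by rewrite invr_gt0.
move=> s es; have s0 : 0 < s by apply: lt_le_trans es; rewrite invr_gt0.
rewrite expRN invf_plt ?posrE ?expR_gt0 //.
by apply: le_lt_trans es _; apply: lt_le_trans (expR_ge1Dx s); rewrite ltrDr.
Qed.

(** A uniform lower bound [q] on the precisions makes every component small as soon
    as a single coordinate is large. *)
Lemma bumps_decay n d (a : 'I_n -> R) (p m : 'I_n -> 'I_d -> R) (q e : R) :
  0 < q -> (forall i j, q <= p i j) -> (forall i, 0 <= a i) -> 0 < e ->
  exists rho : R, forall x : 'cV[R]_d, (exists j, rho < `|x j 0|) -> bumps a p m x < e.
Proof.
move=> q0 qp a0 e0.
pose A := 1 + \sum_i a i.
have A0 : 0 < A by rewrite ltr_pwDl // sumr_ge0.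
have [B B0 HB] := expR_small (divr_gt0 e0 A0).
pose M := \sum_i \sum_j `|m i j|.
have mM i j : `|m i j| <= M.
  rewrite /M (bigD1 i) //= (bigD1 j) //= -addrA lerDl addr_ge0 ?sumr_ge0 //.
  by move=> i' _; exact: sumr_ge0.
exists (M + 1 + 2 * B / q) => x [j xj].
have bsmall i : bump (p i) (m i) x < e / A.
  rewrite /bump mulNr; apply: HB.
  rewrite (bigD1 j) //=.
  have rest : 0 <= \sum_(i0 | i0 != j) p i i0 * (x i0 0 - m i i0) ^+ 2.
    apply: sumr_ge0 => i' _; rewrite mulr_ge0 ?sqr_ge0 //.
    by apply: le_trans (ltW q0) (qp _ _).
  have far : 1 + 2 * B / q <= `|x j 0 - m i j|.
    have := ler_distD (m i j) (x j 0) 0; rewrite !subr0; have := mM i j; lra.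
  have c0 : 0 <= 2 * B / q by rewrite divr_ge0 ?(ltW q0) // mulr_ge0 // ltW.
  have sq : 1 + 2 * B / q <= (x j 0 - m i j) ^+ 2 by rewrite -real_normK ?num_real //; nra.
  have : q * (1 + 2 * B / q) <= p i j * (x j 0 - m i j) ^+ 2.
    by apply: ler_pM => //; [exact: ltW|lra].
  have -> : q * (1 + 2 * B / q) = q + 2 * B by field; rewrite gt_eqF.
  lra.
rewrite /bumps; apply: (@le_lt_trans _ _ (\sum_i a i * (e / A))).
  by apply: ler_sum => i _; rewrite ler_wpM2l // ltW.
rewrite -big_distrl /= mulrCA -[ltRHS]mulr1 ltr_pM2l // ltr_pdivrMr // mul1r.
by rewrite /A ltrDr.
Qed.

(** On the compact part of [K] the maximum of [F] is attained, and the comparison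
    with [F x0] forces the maximizer into the open set [O]. *)
Lemma Mode_exists d (F : 'cV[R]_d -> R) (K O : set 'cV[R]_d) x0 (rho : R) :
  continuous F -> closed K -> open O -> O `<=` K ->
  K x0 -> (forall x, K x -> ~ O x -> F x < F x0) ->
  (forall x : 'cV[R]_d, (exists j, rho < `|x j 0|) -> F x < F x0) ->
  exists2 x, O x & Mode F x.
Proof.
move=> cF cK oO OK Kx0 bnd far.
pose C := [set x : 'cV[R]_d | K x /\ forall j, `|x j 0| <= rho].
have C0 : C x0.
  split=> // j; rewrite leNgt; apply/negP => h.
  by have := far x0 (ex_intro _ j h); rewrite ltxx.
(* Compactness of closed boxes is transported from row vectors to column vectors. *)
pose T := fun v : 'rV[R]_d => v^T.
have cT : continuous T.
  move=> v A /= /nbhs_ballP[e e0 sub]; apply/nbhs_ballP; exists e => // w [_ vw].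
  by apply: sub; split=> // i j; rewrite !mxE.
have cC : compact (C : set 'cV[R]_d).
  have -> : C = T @` ([set v : 'rV[R]_d | forall j, (v 0 j) \in `[(- rho), rho]] `&` T @^-1` K).
    apply/seteqP; split=> [x [Kx xr]|_ [v [vr Kv] <-]].
      exists x^T; last by rewrite /T trmxK.
      split; last by rewrite /= /T trmxK.
      by move=> j; rewrite mxE in_itv /= -ler_norml.
    by split=> // j; have := vr j; rewrite mxE in_itv /= ler_norml.
  apply: continuous_compact; first exact: continuous_subspaceT.
  apply: compact_closedI.
    apply: (@rV_compact _ _ (fun=> `[(- rho), rho]%classic)) => _.
    exact: segment_compact.
  by apply: closed_comp cK => v _; exact: cT.
have [||c] := @compact_EVT_max _ _ F C _ cC; first by exists x0.
  exact: continuous_subspaceT.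
rewrite inE => -[Kc _] maxc.
have maxK x : K x -> F x <= F c.
  move=> Kx; have [Cx|nC] := pselect (C x); first by apply: maxc; rewrite inE.
  apply: le_trans (maxc x0 _); last by rewrite inE.
  apply/ltW/far; apply: contrapT => nj; apply: nC; split => // j.
  by rewrite leNgt; apply/negP => h; apply: nj; exists j.
have Oc : O c.
  apply: contrapT => /(bnd _ Kc); rewrite ltNge => /negP; apply.
  exact: maxK.
exists c => //.
have /nbhs_ballP[e /= e0 sub] : nbhs c O by exact: open_nbhs_nbhs.
exists e => // y yc; apply/maxK/OK/sub.
split => // i k; rewrite ord1 /ball /= .
apply: le_lt_trans yc.
have rest : 0 <= \sum_(i' < d | i' != i) (y - c) i' 0 ^+ 2.
  by apply: sumr_ge0 => i' _; exact: sqr_ge0.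
rewrite /eucl_norm (bigD1 i) //= distrC -sqrtr_sqr ler_sqrt.
  by rewrite !mxE lerDl.
by rewrite addr_ge0 ?sqr_ge0.
Qed.

Lemma Mode_exists_ineq d (F g1 g2 g3 : 'cV[R]_d -> R) x0 (rho : R) :
  continuous F -> continuous g1 -> continuous g2 -> continuous g3 ->
  0 <= g1 x0 -> 0 <= g2 x0 -> 0 <= g3 x0 ->
  (forall x, 0 <= g1 x -> 0 <= g2 x -> 0 <= g3 x ->
     [\/ g1 x = 0, g2 x = 0 | g3 x = 0] -> F x < F x0) ->
  (forall x : 'cV[R]_d, (exists j, rho < `|x j 0|) -> F x < F x0) ->
  exists2 x, Mode F x & [/\ 0 < g1 x, 0 < g2 x & 0 < g3 x].
Proof.
move=> cF c1 c2 c3 p1 p2 p3 bnd far.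
pose K g := [set x : 'cV[R]_d | 0 <= (g x : R)].
pose O g := [set x : 'cV[R]_d | 0 < (g x : R)].
have cK g : continuous g -> closed (K g).
  by move=> cg; apply: (@closed_comp _ _ g [set y | 0 <= y]) => [x _|];
    [exact: cg|exact: closed_ge].
have oO g : continuous g -> open (O g).
  by move=> cg; apply: (@open_comp _ _ g [set y | 0 < y]) => [x _|];
    [exact: cg|exact: open_gt].
have [||||x Kx nOx||x [[O1 O2] O3] mx] := @Mode_exists _ F (K g1 `&` K g2 `&` K g3)
    (O g1 `&` O g2 `&` O g3) x0 rho cF.
- by apply: closedI; [apply: closedI|]; exact: cK.
- by apply: openI; [apply: openI|]; exact: oO.
- by move=> x [[/ltW ? /ltW ?] /ltW ?].
- by [].
- case: Kx => -[k1 k2] k3; apply: bnd => //.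
  have [g1x|g1x] := eqVneq (g1 x) 0; first by constructor 1.
  have [g2x|g2x] := eqVneq (g2 x) 0; first by constructor 2.
  have [g3x|g3x] := eqVneq (g3 x) 0; first by constructor 3.
  by exfalso; apply: nOx; rewrite /O /= !lt0r g1x g2x g3x k1 k2 k3.
- exact: far.
by exists x.
Qed.
End Bumps.

(** * Two components with d + 1 modes *)

Section Construction.
Context {R : realType} (d0 : nat).
Local Notation d := d0.+1.

(** Any precision works for which the three inequalities [48 <= prec],
    [d * prec <= exp (prec / 2)] and [prec <= exp (prec / 8)] hold. *)
Definition prec : R := 48 * d%:R.
Definition ratio : R := expR (prec / 2).
(** With this weight the logarithm of the odds at a corner [c > 0] is about
    [c p / 2 - p / 8], well inside the interval between the levels [c - 1] and [c]. *)
Definition weight : R := expR (- (prec / 8)).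
Definition wide (j : nat) : R := prec / ratio ^+ j.

Local Notation p := prec.
Local Notation th := ratio.
Local Notation om := weight.
Local Notation q := wide.

Lemma dim_ge1 : 1 <= d%:R :> R. Proof. by rewrite ler1n. Qed.
Lemma prec_ge48 : 48 <= p. Proof. by have := dim_ge1; rewrite /prec; lra. Qed.
Lemma prec_gt0 : 0 < p. Proof. by have := prec_ge48; lra. Qed.
Lemma ratio_gt0 : 0 < th. Proof. exact: expR_gt0. Qed.
Lemma weight_gt0 : 0 < om. Proof. exact: expR_gt0. Qed.
Lemma weight_lt1 : om < 1.
Proof. by rewrite expR_lt1; have := prec_gt0; lra. Qed.
Lemma wide_gt0 j : 0 < q j.
Proof. by rewrite divr_gt0 ?exprn_gt0 ?ratio_gt0 ?prec_gt0. Qed.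
Hint Resolve prec_gt0 ratio_gt0 weight_gt0 wide_gt0 : core.

(** The errors of the estimates below are [d] terms of size at most
    [prec / ratio] each; their sum is at most 1. *)
Lemma prec_ratio : d%:R * p <= th.
Proof.
have -> : th = expR (12 * d%:R) ^+ 2.
  by rewrite /ratio -expRM_natl /prec; congr expR; field.
have h := expR_ge1Dx (12 * d%:R : R); have D1 := dim_ge1.
rewrite /prec; nra.
Qed.

Lemma ratio_ge48 : 48 <= th.
Proof. by have := prec_ratio; have := dim_ge1; have := prec_ge48; nra. Qed.

Lemma ratioX_ge1 n : 1 <= th ^+ n.
Proof. by rewrite exprn_ege1 //; have := ratio_ge48; lra. Qed.

Lemma dim_prec_ratio : d%:R * (p / th) <= 1.
Proof. by rewrite mulrA ler_pdivrMr // mul1r prec_ratio. Qed.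

Lemma weight_prec : om * p <= 1.
Proof.
rewrite /weight expRN mulrC ler_pdivrMr ?expR_gt0 // mul1r.
have -> : expR (prec / 8) = expR (d%:R : R) ^+ 6.
  by rewrite -expRM_natl /prec; congr expR; field.
have h := expR_ge1Dx (d%:R : R); have D1 := dim_ge1.
have h2 : (1 + d%:R) ^+ 6 <= expR (d%:R : R) ^+ 6.
  by apply: lerXn2r h; rewrite nnegrE; [lra|exact: expR_ge0].
apply: le_trans h2; rewrite /prec.
have h4 : 16 <= (1 + d%:R : R) ^+ 4.
  have -> : 16 = (2 : R) ^+ 4 by ring.
  by apply: lerXn2r; rewrite ?nnegrE; lra.
rewrite (_ : (1 + d%:R) ^+ 6 = (1 + d%:R : R) ^+ 4 * (1 + d%:R) ^+ 2); last by rewrite -exprD.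
nra.
Qed.

(** At corner [c] the wide component has the value
    [weight * exp (- tail c / 2)]: only the coordinates still at 0 contribute. *)
Definition tail (c : nat) : R := \sum_(j < d) (c <= j)%:R * q j.
Local Notation W c := (om * expR (- (tail c / 2))).

Lemma tail_ge0 c : 0 <= tail c.
Proof. by apply: sumr_ge0 => j _; rewrite mulr_ge0 ?ler0n // ltW. Qed.

Lemma wide_le j : (0 < j)%N -> q j <= p / th.
Proof.
move=> j0; rewrite /wide ler_pM2l // lef_pV2 ?posrE ?exprn_gt0 //.
by rewrite ler_eXnr //; have := ratio_ge48; lra.
Qed.

Lemma tail_le1 c : (0 < c)%N -> tail c <= 1.
Proof.
move=> c0; apply: le_trans dim_prec_ratio.
rewrite mulr_natl -[d in leRHS]card_ord -sumr_const; apply: ler_sum => j _.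
case: leqP => cj; last by rewrite mul0r divr_ge0 // ltW.
by rewrite mul1r wide_le // (leq_trans c0).
Qed.

Lemma tailS (c : 'I_d) : tail c = q c + tail c.+1.
Proof.
rewrite /tail (bigD1 c) //= leqnn mul1r [in RHS](bigD1 c) //= ltnn mul0r add0r.
congr (_ + _); apply: eq_bigr => j jc; congr (_%:R * _).
by rewrite [in RHS]ltn_neqAle eq_sym -val_eqE in jc *; rewrite jc.
Qed.

Definition narrow_part (x : 'cV[R]_d) : R := expR (- (p / 2 * \sum_j x j 0 ^+ 2)).
Definition wide_part (x : 'cV[R]_d) : R :=
  om * bump (fun j : 'I_d => q j) (fun=> 1) x.
(** Logarithm of the ratio between the wide and the narrow component, see
    [wide_partE]. *)
Definition log_odds (x : 'cV[R]_d) : R :=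
  - (p / 8) - (1 / 2) * (\sum_(j < d) q j * (x j 0 - 1) ^+ 2) + p / 2 * \sum_j x j 0 ^+ 2.

Lemma wide_partE x : wide_part x = narrow_part x * expR (log_odds x).
Proof.
rewrite /wide_part /narrow_part /bump -!expRD; congr expR; rewrite /log_odds; ring.
Qed.

(** The right-hand side is minimal at [x = r / (1 + r)]. *)
Lemma weighted_square (r x : R) : 0 < r -> r / (1 + r) <= x ^+ 2 + r * (x - 1) ^+ 2.
Proof.
move=> r0; rewrite ler_pdivrMr ?addr_gt0 // -subr_ge0.
rewrite (_ : _ - _ = (x * (1 + r) - r) ^+ 2) ?sqr_ge0 //; ring.
Qed.

(** On the level [c] the wide component carries the weight [th ^ c] relative to the
    narrow one.  Minimizing the weighted sum of the two quadratics in coordinate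
    [j] gives [p r / (1 + r)] with [r = th ^ (c - j)], which is close to [p] for
    [j < c], close to [p r] for [j > c], and equal to [p / 2] for [j = c]. *)
Lemma level_coord (c j : nat) (x : R) :
  (j < c)%:R * p + (j == c)%:R * (p / 2) + th ^+ c * ((c < j)%:R * q j) - p / th
  <= p * x ^+ 2 + th ^+ c * (q j * (x - 1) ^+ 2).
Proof.
have [r rE] : exists r, r = th ^+ c / th ^+ j by eexists.
have tc : 0 < th ^+ c by rewrite exprn_gt0.
have tj : 0 < th ^+ j by rewrite exprn_gt0.
have r0 : 0 < r by rewrite rE divr_gt0.
have qE : th ^+ c * q j = p * r by rewrite /wide rE; field; rewrite gt_eqF.
have ith0 : 0 < th^-1 by rewrite invr_gt0.
have ith1 : th^-1 < 1 by rewrite invf_lt1 //; have := ratio_ge48; lra.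
have H := @weighted_square r x r0.
have P := prec_gt0.
have -> : p * x ^+ 2 + th ^+ c * (q j * (x - 1) ^+ 2) = p * (x ^+ 2 + r * (x - 1) ^+ 2).
  by rewrite mulrA qE; ring.
apply: (@le_trans _ _ (p * (r / (1 + r)))); last by rewrite ler_pM2l.
have -> : th ^+ c * ((c < j)%:R * q j) = (c < j)%:R * (p * r) by rewrite -qE; ring.
have K : r / (1 + r) = 1 - (1 + r)^-1 by field; rewrite gt_eqF // addr_gt0.
case: (ltngtP j c) => jc.
- have rth : th <= r. 
    have -> : r = th * th ^+ (c - j.+1).
      rewrite rE -{1}(subnKC jc) exprD exprS; field; exact: lt0r_neq0.
    by apply: ler_peMr; [exact: ltW|exact: ratioX_ge1].
  have : (1 + r)^-1 <= th^-1.
    by rewrite lef_pV2 ?posrE //; [have := ratio_gt0; lra|rewrite addr_gt0].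
  rewrite !mul1r !mul0r K; nra.
- have rth : r <= th^-1.
    have -> : r = th^-1 * (th ^+ (j - c.+1))^-1.
      rewrite rE -{1}(subnKC jc) exprD exprS; field.
      by rewrite !lt0r_neq0 ?exprn_gt0.
    by apply: ler_piMr; [exact: ltW|rewrite invf_le1 ?exprn_gt0 ?ratioX_ge1].
  have H' : r - r ^+ 2 <= r / (1 + r) by rewrite ler_pdivlMr ?addr_gt0 //; nra.
  have {H'} : 0 <= r / (1 + r) - r + th^-1 by nra.
  move=> /(mulr_ge0 (ltW P)); rewrite !mul1r !mul0r; lra.
- have -> : r / (1 + r) = 1 / 2 by rewrite rE jc divff ?gt_eqF.
  have := mulr_ge0 (ltW P) (ltW ith0); rewrite !mul1r !mul0r; lra.
Qed.

Lemma sum_ltn (c : nat) : (c <= d)%N -> \sum_(j < d) (j < c)%:R = c%:R :> R.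
Proof.
move=> cd; rewrite -natr_sum; congr _%:R.
transitivity (\sum_(j < d | (j < c)%N) 1)%N.
  by rewrite [RHS]big_mkcond; apply: eq_bigr => j _; case: ltnP.
by rewrite -(big_ord_widen d (fun=> 1%N) cd) sum1_card card_ord.
Qed.

(** With [k = th ^ c], the value on the level is [(1 + k) exp (- s)], and the level
    equation gives [k s] in terms of the quadratic [t] of the wide component.
    Summing [level_coord] over [j] bounds [(1 + k) s] from below; the term [p / 2]
    of the coordinate [j = c] is the gain that places the level below the corners. *)
Lemma level_le (c : 'I_d) x : log_odds x = c%:R * (p / 2) ->
  wide_part x + narrow_part x <= W c.+1.
Proof.
move=> lx; rewrite wide_partE lx.
pose s := p / 2 * \sum_j x j 0 ^+ 2.
pose t := \sum_(j < d) q j * (x j 0 - 1) ^+ 2.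
pose k := th ^+ c.
have kE : expR (c%:R * (p / 2)) = k by rewrite expRM_natl.
have k1 : 1 <= k by exact: ratioX_ge1.
have sum_ge : c%:R * p + p / 2 + k * tail c.+1 - 1 <= 2 * s + k * t.
  have -> : 2 * s + k * t = \sum_(j < d) (p * x j 0 ^+ 2 + k * (q j * (x j 0 - 1) ^+ 2)).
    by rewrite big_split /= -!big_distrr /= /s /t; field.
  apply: (le_trans _ (ler_sum _ (fun (j : 'I_d) _ => level_coord c j (x j 0)))).
  rewrite !big_split /= -!big_distrl -!big_distrr /= sum_ltn; last exact: ltnW.
  rewrite sumr_const card_ord (bigD1 c) //= eqxx big1 ?addr0 ?mul1r; last first.
    by move=> j jc; rewrite val_eqE (negbTE jc).
  by have := dim_prec_ratio; rewrite mulNrn -[(p / th) *+ d]mulr_natl -/k /tail; lra.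
have id : k * s = k * (c%:R * (p / 2)) + k * (p / 8) + k * t / 2.
  by rewrite -lx /log_odds -/s -/t; field.
have k1e : 1 + k <= expR (c%:R * (p / 2) + k^-1).
  rewrite expRD kE; have := expR_ge1Dx k^-1; rewrite -(ler_pM2l (lt_le_trans ltr01 k1)).
  by rewrite mulrDr mulr1 divff ?gt_eqF ?(lt_le_trans ltr01 k1) // addrC.
rewrite /narrow_part -/s kE -[X in _ + X]mulr1 -mulrDr mulrC addrC.
apply: (@le_trans _ _ (expR (c%:R * (p / 2) + k^-1) * expR (- s))).
  by rewrite ler_pM2r ?expR_gt0.
rewrite /weight -!expRD ler_expR.
have := tail_le1 (ltn0Sn c); have := tail_ge0 c.+1.
have kV : k^-1 * k = 1 by rewrite mulVf // gt_eqF // (lt_le_trans ltr01 k1).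
have kV1 : k^-1 <= 1 by rewrite invf_le1 // (lt_le_trans ltr01 k1).
have p48' := prec_ge48; move=> T0 T1.
rewrite -subr_ge0 -(pmulr_rge0 _ (_ : 0 < 1 + k)); last by lra.
nra.
Qed.

Definition corner (c : nat) : 'cV[R]_d := \col_j (j < c)%:R.

Lemma narrow_corner c : (c <= d)%N -> narrow_part (corner c) = (th ^+ c)^-1.
Proof.
move=> cd; rewrite /narrow_part expRN /ratio -expRM_natl; congr (expR _)^-1.
rewrite mulrC; congr (_ * _); rewrite -[RHS](sum_ltn cd); apply: eq_bigr => j _.
by rewrite mxE; case: ltnP => _; rewrite ?expr1n ?expr0n.
Qed.

Lemma sum_corner c : \sum_(j < d) q j * (corner c j 0 - 1) ^+ 2 = tail c.
Proof.
apply: eq_bigr => j _; rewrite mxE mulrC; congr (_ * _).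
by case: ltnP => _ /=; rewrite ?subrr ?expr0n // sub0r sqrrN expr1n.
Qed.

Lemma wide_corner c : wide_part (corner c) = W c.
Proof. by rewrite /wide_part /bump sum_corner; congr (_ * expR _); field. Qed.

Lemma log_odds_corner c : (c <= d)%N ->
  log_odds (corner c) = - (p / 8) - tail c / 2 + c%:R * (p / 2).
Proof.
move=> cd; rewrite /log_odds sum_corner -(sum_ltn cd).
rewrite (eq_bigr (fun j : 'I_d => (j < c)%:R)); first by ring.
by move=> j _; rewrite mxE; case: ltnP => _; rewrite ?expr1n ?expr0n.
Qed.

Lemma log_odds_corner_lt c : (c <= d)%N -> log_odds (corner c) < c%:R * (p / 2).
Proof.
move=> cd; rewrite log_odds_corner //; have := tail_ge0 c; have := prec_gt0; lra.
Qed.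

Lemma log_odds_corner_gt c : (c < d)%N -> c%:R * (p / 2) < log_odds (corner c.+1).
Proof.
move=> cd; rewrite log_odds_corner // -[c.+1%:R]natr1 mulrDl.
have := tail_le1 (ltn0Sn c); have := prec_ge48; lra.
Qed.

(** A margin by which all corners exceed the levels next to them; it leaves room for
    the contribution of the remote components. *)
Definition gap : R := (th ^+ d)^-1 / 2.

Lemma gap_gt0 : 0 < gap.
Proof. by rewrite divr_gt0 // invr_gt0 exprn_gt0. Qed.

Lemma gap_le c : (c <= d)%N -> gap <= (th ^+ c)^-1 / 2.
Proof.
move=> cd; rewrite ler_pM2r // lef_pV2 ?posrE ?exprn_gt0 // ler_weXn2l //.
by have := ratio_ge48; lra.
Qed.

(** Passing from corner [c + 1] to corner [c] costs the wide component at most the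
    fraction [q_c / 2], while the narrow component contributes [th ^ - c]; half of
    the latter pays for the loss since [weight * prec <= 1]. *)
Lemma corner_above_right (c : 'I_d) :
  W c.+1 + gap <= wide_part (corner c) + narrow_part (corner c).
Proof.
rewrite narrow_corner ?wide_corner; last exact: ltnW.
have g := gap_le (ltnW (ltn_ord c)).
have tc : 0 < (th ^+ c)^-1 by rewrite invr_gt0 exprn_gt0.
have [e eE] : exists e, e = expR (- (tail c.+1 / 2)) by eexists.
have e0 : 0 < e by rewrite eE expR_gt0.
have e1 : e <= 1 by rewrite eE expR_le1; have := tail_ge0 c.+1; lra.
have -> : W c = om * e * expR (- (q c / 2)).
  by rewrite -mulrA eE -expRD tailS; congr (_ * expR _); field.
have h := expR_ge1Dx (- (q c / 2)).
rewrite -eE; have : om * e * (1 + - (q c / 2)) <= om * e * expR (- (q c / 2)).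
  by rewrite ler_wpM2l // mulr_ge0 ?ltW.
have : om * e * q c <= (th ^+ c)^-1.
  rewrite /wide mulrA ler_piMl ?(ltW tc) //.
  apply: le_trans weight_prec; rewrite mulrAC ler_piMr // mulr_ge0 // ltW //.
by lra.
Qed.

Lemma corner_above_left (c : 'I_d) :
  W c.+1 + gap <= wide_part (corner c.+1) + narrow_part (corner c.+1).
Proof.
rewrite narrow_corner ?wide_corner // lerD2l.
apply: le_trans (gap_le (ltn_ord c)) _.
have : 0 < (th ^+ c.+1)^-1 by rewrite invr_gt0 exprn_gt0.
lra.
Qed.

Lemma corner_ge_gap c : (c <= d)%N ->
  gap <= wide_part (corner c) + narrow_part (corner c).
Proof.
move=> cd; rewrite narrow_corner // wide_corner.
have : 0 <= W c by rewrite mulr_ge0 ?expR_ge0 ?ltW.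
have : 0 < (th ^+ c)^-1 by rewrite invr_gt0 exprn_gt0.
have := gap_le cd; lra.
Qed.

Lemma log_odds_continuous : continuous log_odds.
Proof.
have c1 := @continuous_scaleR _ _ (1 / 2) _ (@quad_continuous _ d (fun j => q j) (fun=> 1)).
have c2 := @continuous_scaleR _ _ (p / 2) _ (@quad_continuous _ d (fun=> 1) (fun=> 0)).
have -> : log_odds = (fun y => - (p / 8) - 1 / 2 * (\sum_(j < d) q j * (y j 0 - 1) ^+ 2)
    + p / 2 * \sum_(j < d) 1 * (y j 0 - 0) ^+ 2).
  apply/funext => y /=; rewrite /log_odds; congr (_ + _ * _).
  by apply: eq_bigr => j _; rewrite mul1r subr0.
move=> x; exact: (continuousD
  (continuousB (@cvg_cst _ (- (p / 8)) _ (nbhs x) _) (c1 x)) (c2 x)).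
Qed.

(** * Adding remote narrow components *)

Context (k0 : nat) (B : R).

(** The first coordinate is separated from the others since the narrow components
    differ only there; [spike 0] is [narrow_part]. *)
Definition spike (i : nat) (x : 'cV[R]_d) : R :=
  expR (- (p / 2 * ((x ord0 0 + 2 * B * i%:R) ^+ 2 +
                    \sum_(j < d0) x (lift ord0 j) 0 ^+ 2))).

Definition mix (x : 'cV[R]_d) : R := wide_part x + \sum_(i < k0.+1) spike i x.

(** Index 0 is the wide component; index [i + 1] is [spike i]. *)
Definition mix_amp (i : 'I_k0.+2) : R := if i == 0 :> nat then om else 1.
Definition mix_prec (i : 'I_k0.+2) (j : 'I_d) : R :=
  if i == 0 :> nat then q j else p.
Definition mix_mean (i : 'I_k0.+2) (j : 'I_d) : R :=
  if i == 0 :> nat then 1 else if j == 0 :> nat then - (2 * B * i.-1%:R) else 0.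

Lemma bump_spike (i : 'I_k0.+1) x :
  bump (mix_prec (lift ord0 i)) (mix_mean (lift ord0 i)) x = spike i x.
Proof.
rewrite /spike /bump big_ord_recl {1}/mix_prec {1}/mix_mean /=; congr expR.
rewrite [X in _ * (_ + X) = _](_ : _ = p * \sum_(j < d0) x (lift ord0 j) 0 ^+ 2).
  by rewrite add0n opprK; field.
rewrite big_distrr; apply: eq_bigr => j _.
by rewrite /mix_prec /mix_mean /= subr0.
Qed.

Lemma mixE : mix = bumps mix_amp mix_prec mix_mean.
Proof.
apply/funext => x; rewrite /mix /bumps [in RHS]big_ord_recl; congr (_ + _).
by apply: eq_bigr => i _; rewrite bump_spike mul1r.
Qed.

Lemma mix_amp_gt0 i : 0 < mix_amp i.
Proof. by rewrite /mix_amp; case: ifP. Qed.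

Lemma mix_prec_gt0 i j : 0 < mix_prec i j.
Proof. by rewrite /mix_prec; case: ifP. Qed.

Lemma spike0 x : spike 0 x = narrow_part x.
Proof.
by rewrite /spike /narrow_part mulr0 addr0 [in RHS]big_ord_recl.
Qed.

Lemma spike_gt0 i x : 0 < spike i x. Proof. exact: expR_gt0. Qed.

Lemma mix_continuous : continuous mix.
Proof. by rewrite mixE; exact: bumps_continuous. Qed.

Lemma mix_decay e : 0 < e ->
  exists rho : R, forall x : 'cV[R]_d, (exists j, rho < `|x j 0|) -> mix x < e.
Proof.
move=> e0; rewrite mixE; apply: (@bumps_decay _ _ _ _ _ _ (q d)) => //.
  move=> i j; rewrite /mix_prec; have qE n : q n = p * (th ^+ n)^-1 by [].
  have qd : q d <= q j.
    rewrite !qE ler_pM2l // lef_pV2 ?posrE ?exprn_gt0 // ler_weXn2l //; last exact: ltnW.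
    by have := ratio_ge48; lra.
  case: ifP => // _; apply: le_trans qd _.
  by rewrite qE; apply: ler_piMr; [exact: ltW|rewrite invf_le1 ?exprn_gt0 ?ratioX_ge1].
by move=> i; rewrite ltW // mix_amp_gt0.
Qed.

Local Notation eps := (expR (- (p / 2 * B ^+ 2))).

Lemma spike_le i (x : 'cV[R]_d) : B ^+ 2 <= (x ord0 0 + 2 * B * i%:R) ^+ 2 -> spike i x <= eps.
Proof.
move=> h; rewrite ler_expR lerN2 ler_pM2l ?divr_gt0 //.
by rewrite -[leLHS]addr0 lerD // sumr_ge0 // => j _; exact: sqr_ge0.
Qed.

Context (B0 : 0 < B).

Lemma wide_part_le (x : 'cV[R]_d) : x ord0 0 <= - B -> wide_part x <= eps.
Proof.
move=> xB; rewrite -[eps]mul1r ler_pM ?expR_ge0 ?(ltW weight_gt0) ?(ltW weight_lt1) //.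
rewrite ler_expR big_ord_recl /= mulNr lerN2.
have rest : 0 <= \sum_(i < d0) q (lift ord0 i) * (x (lift ord0 i) 0 - 1) ^+ 2.
  by apply: sumr_ge0 => i _; rewrite mulr_ge0 ?sqr_ge0 ?(ltW (wide_gt0 _)).
have -> : q 0 = p by rewrite /wide expr0 divr1.
have : B ^+ 2 <= (x ord0 0 - 1) ^+ 2 by have := B0; nra.
move=> /(ler_wpM2l (ltW prec_gt0)); move: rest; rewrite /bump /=; lra.
Qed.

Lemma mix_right_le (x : 'cV[R]_d) : - B <= x ord0 0 -> mix x <= wide_part x + narrow_part x + k0%:R * eps.
Proof.
move=> xB; rewrite /mix big_ord_recl spike0 addrA lerD2l.
rewrite mulr_natl -[k0 in leRHS]card_ord -sumr_const; apply: ler_sum => i _.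
apply: spike_le; have i1 : 1 <= (lift ord0 i)%:R :> R by rewrite ler1n.
have h : B <= x ord0 0 + 2 * B * (lift ord0 i)%:R by have := B0; nra.
by apply: lerXn2r => //; rewrite nnegrE; have := B0; lra.
Qed.

Lemma mix_ge (x : 'cV[R]_d) : wide_part x + narrow_part x <= mix x.
Proof.
rewrite /mix big_ord_recl spike0 addrA lerDl sumr_ge0 // => i _.
exact: ltW (spike_gt0 _ _).
Qed.

Lemma mix_ge_spike (i : 'I_k0.+1) (x : 'cV[R]_d) : spike i x <= mix x.
Proof.
rewrite /mix (bigD1 i) //= addrCA lerDl addr_ge0 ?sumr_ge0 // => [|j _].
  by rewrite mulr_ge0 ?expR_ge0 ?ltW.
exact: ltW (spike_gt0 _ _).
Qed.

(** At odd multiples of [- B] the first coordinate is at distance at least [B] from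
    the centre of every component, and all of them have the precision [p] there. *)
Lemma mix_wall (n : nat) (x : 'cV[R]_d) : x ord0 0 = - ((2 * n%:R + 1) * B) -> mix x <= k0.+2%:R * eps.
Proof.
move=> xE; have n0 : 0 <= n%:R :> R by exact: ler0n.
rewrite -natr1 addrC mulrDl mul1r lerD //; first by apply: wide_part_le; have := B0; nra.
rewrite mulr_natl -[k0.+1 in leRHS]card_ord -sumr_const; apply: ler_sum => i _.
apply: spike_le; rewrite xE.
have -> : - ((2 * n%:R + 1) * B) + 2 * B * i%:R = B * (2 * (i%:R - n%:R) - 1) by ring.
rewrite exprMn ler_peMr ?sqr_ge0 //.
have [ni|ni] := ltnP n i.
  have : n%:R + 1 <= i%:R :> R by rewrite natr1 ler_nat.
  nra.
have : i%:R <= n%:R :> R by rewrite ler_nat.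
nra.
Qed.
End Construction.

(** * Counting modes *)

Section Modes.
Context {R : realType} (d0 k0 : nat) (B : R).
Local Notation d := d0.+1.
Local Notation p := (@prec R d0).
Local Notation mix := (@mix R d0 k0 B).
Local Notation eps := (expR (- (p / 2 * B ^+ 2))).
Context (B0 : 0 < B) (epsP : k0.+2%:R * eps < gap d0).

(** The two inequalities [0 < above n x] and [0 < below n x] put [log_odds x]
    between the levels [n - 1] and [n].  The constant 1 drops the lower bound at the
    first corner and the upper bound at the last one. *)
Definition above (n : nat) (x : 'cV[R]_d) : R :=
  if n is n'.+1 then log_odds x - n'%:R * (p / 2) else 1.
Definition below (n : nat) (x : 'cV[R]_d) : R :=
  if (n < d)%N then n%:R * (p / 2) - log_odds x else 1.

Lemma coord_shift_continuous (c : R) : continuous (fun x : 'cV[R]_d => x ord0 0 + c).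
Proof.
move=> x; exact: (continuousD (@coord_continuous _ _ _ ord0 0 x) (@cvg_cst _ c _ (nbhs x) _)).
Qed.

Lemma above_continuous n : continuous (above n).
Proof.
case: n => [|n]; first exact: cst_continuous.
move=> x; exact: (continuousB (@log_odds_continuous R d0 x) (@cvg_cst _ _ _ (nbhs x) _)).
Qed.

Lemma below_continuous n : continuous (below n).
Proof.
rewrite /below; case: (n < d)%N; last exact: cst_continuous.
move=> x; exact: (continuousB (@cvg_cst _ _ _ (nbhs x) _) (@log_odds_continuous R d0 x)).
Qed.

(** The region [- B < x_0] between the levels [n - 1] and [n] contains corner [n],
    where the density is greater than on the boundary and far away. *)
Lemma mode_corner n : (n <= d)%N ->
  exists2 x, Mode mix x & [/\ 0 < x ord0 0 + B, 0 < above n x & 0 < below n x].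
Proof.
move=> nd.
have eps0 : 0 < eps by exact: expR_gt0.
have gE : k0%:R * eps < gap d0.
  by apply: le_lt_trans epsP; rewrite ler_pM2r // ler_nat leqW.
have mc := mix_ge k0 B (corner d0 n : 'cV[R]_d).
have mc0 : 0 < mix (corner d0 n).
  by apply: lt_le_trans mc; apply: lt_le_trans (corner_ge_gap nd); exact: gap_gt0.
have [rho far] := @mix_decay R d0 k0 B _ mc0.
apply: (@Mode_exists_ineq _ _ _ _ _ _ (corner d0 n) rho) far.
- exact: mix_continuous.
- exact: coord_shift_continuous.
- exact: above_continuous.
- exact: below_continuous.
- by rewrite mxE addr_ge0 ?ler0n // ltW.
- case: n nd {mc mc0} => [|n] nd //=; rewrite subr_ge0 ltW //.
  exact: log_odds_corner_gt.
- by rewrite /below; case: ifP => // _; rewrite subr_ge0 ltW // log_odds_corner_lt.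
move=> x xB _ _; case.
- move=> /eqP; rewrite addr_eq0 => /eqP xE.
  apply: (@le_lt_trans _ _ (k0.+2%:R * eps)).
    by apply: (@mix_wall _ _ _ _ _ 0) => //; rewrite xE mulr0 add0r mul1r.
  by apply: lt_le_trans mc; apply: lt_le_trans epsP _; exact: corner_ge_gap.
- case: n nd mc {mc0} => [|n] nd mc /eqP; first by rewrite oner_eq0.
  rewrite subr_eq0 => /eqP lx.
  have xB' : - B <= x ord0 0 by lra.
  have H := @level_le R d0 (Ordinal nd) x lx.
  have H' := @corner_above_left R d0 (Ordinal nd).
  have := mix_right_le k0 B0 xB'; move: H H' mc => /=; lra.
- rewrite /below; case: ifP => nd' /eqP; last by rewrite oner_eq0.
  rewrite subr_eq0 => /eqP/esym lx.
  have xB' : - B <= x ord0 0 by lra.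
  have H := @level_le R d0 (Ordinal nd') x lx.
  have H' := @corner_above_right R d0 (Ordinal nd').
  have := mix_right_le k0 B0 xB'; move: H H' mc => /=; lra.
Qed.

(** Between two walls the density reaches the value 1 at the centre of the spike and
    is less than [gap] on the walls. *)
Lemma mode_spike i : (0 < i <= k0)%N -> exists2 x, Mode mix x &
  0 < x ord0 0 + (2 * i%:R + 1) * B /\ 0 < - x ord0 0 - (2 * i%:R - 1) * B.
Proof.
move=> /andP[i0 ik]; pose x0 : 'cV[R]_d := \col_j ((j == ord0)%:R * (- (2 * B * i%:R))).
have x00 : x0 ord0 0 = - (2 * B * i%:R) by rewrite mxE mul1r.
have eps0 : 0 < eps by exact: expR_gt0.
have gap1 : gap d0 <= 1 :> R.
  by have := @gap_le R d0 0 isT; rewrite expr0 invr1; lra.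
have m1 : 1 <= mix x0.
  have ik1 : (i < k0.+1)%N by rewrite ltnS.
  apply: le_trans (@mix_ge_spike _ _ k0 B (Ordinal ik1) _).
  rewrite /spike x00 addNr expr0n add0r big1 ?mulr0 ?oppr0 ?expR0 // => j _.
  by rewrite mxE mul0r expr0n.
have [rho far] := @mix_decay R d0 k0 B _ (lt_le_trans ltr01 m1).
suff [x mx [x1 x2 _]] : exists2 x, Mode mix x &
    [/\ 0 < x ord0 0 + (2 * i%:R + 1) * B, 0 < - x ord0 0 - (2 * i%:R - 1) * B & 0 < 1 :> R].
  by exists x.
apply: (@Mode_exists_ineq _ _ mix (fun x => x ord0 0 + (2 * i%:R + 1) * B)
   (fun x => - x ord0 0 - (2 * i%:R - 1) * B) (fun=> 1) x0 rho) far.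
- exact: mix_continuous.
- exact: coord_shift_continuous.
- move=> x; have cn := continuousN (@coord_continuous _ _ _ (ord0 : 'I_d) 0 x).
  exact: (continuousD cn (@cvg_cst _ _ _ (nbhs x) _)).
- exact: cst_continuous.
- by rewrite x00; have := B0; lra.
- by rewrite x00; have := B0; lra.
- by [].
- move=> x _ _ _ [xE|xE|/eqP]; last by rewrite oner_eq0.
    apply: le_lt_trans (@mix_wall R d0 k0 B B0 i x _) _; last by exact: lt_le_trans (lt_le_trans epsP gap1) m1.
    lra.
  apply: le_lt_trans (@mix_wall R d0 k0 B B0 i.-1 x _) _; last by exact: lt_le_trans (lt_le_trans epsP gap1) m1.
  have : i%:R = i.-1%:R + 1 :> R by rewrite natr1 prednK.
  by move=> iE; rewrite iE in xE; lra.
Qed.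

(** The indices [n <= d] are those of the corners, the others those of the spikes;
    the regions of distinct indices are disjoint. *)
Lemma many_modes : finite_set (Mode mix) ->
  (d + k0.+2 - 1 <= #|` fset_set (Mode mix)|)%N.
Proof.
move=> fM.
pose reg (n : nat) (x : 'cV[R]_d) := if (n <= d)%N then
    [/\ 0 < x ord0 0 + B, 0 < above n x & 0 < below n x]
  else 0 < x ord0 0 + (2 * (n - d)%:R + 1) * B /\ 0 < - x ord0 0 - (2 * (n - d)%:R - 1) * B.
have ex (n : 'I_(d + k0.+1)) : exists x, Mode mix x /\ reg n x.
  rewrite /reg; case: leqP => nd.
    by have [x ? ?] := mode_corner nd; exists x.
  have [|x ? ?] := @mode_spike (n - d)%N; last by exists x.
  by rewrite subn_gt0 nd leq_subLR -ltnS -addnS ltn_ord.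
have [f Hf] := choice ex.
have sep (n m : nat) x : (n < m)%N -> reg n x -> reg m x -> False.
  rewrite /reg => nm; case: leqP => nd; case: leqP => md.
  - move=> [_ _]; rewrite /below (leq_trans nm md) => b [_ a _].
    case: m nm md a => // m; rewrite ltnS => nm _ /= a.
    have : n%:R <= m%:R :> R by rewrite ler_nat.
    move=> /(ler_wpM2r (ltW (@prec_gt0 R d0))); lra.
  - move=> [xB _ _] [_].
    have : 1 <= (m - d)%:R :> R by rewrite ler1n subn_gt0.
    have := B0; nra.
  - by have := leq_trans nm md; rewrite ltnNge (ltnW nd).
  - move=> [xB _] [_].
    have : (n - d)%:R + 1 <= (m - d)%:R :> R by rewrite natr1 ler_nat ltn_sub2r // (ltn_trans nd).
    have := B0; nra.
have inj : injective f.
  move=> n m fnm; have [_ rn] := Hf n; have [_ rm] := Hf m; rewrite fnm in rn.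
  case: (ltngtP n m) => [nm|mn|/val_inj//].
    by case: (sep _ _ _ nm rn rm).
  by case: (sep _ _ _ mn rm rn).
have -> : (d + k0.+2 - 1 = size [seq f n | n <- enum 'I_(d + k0.+1)])%N.
  by rewrite size_map -cardE card_ord addnS subn1.
apply: uniq_leq_size; first by rewrite map_inj_uniq // enum_uniq.
move=> _ /mapP[n _ ->]; rewrite in_fset_set // inE.
by case: (Hf n).
Qed.
End Modes.

(** * Finiteness of the set of modes *)

Section Finiteness.
Context {R : realType} (d0 k0 : nat) (B : R).
Local Notation d := d0.+1.
Local Notation p := (@prec R d0).
Local Notation th := (@ratio R d0).
Local Notation q := (@wide R d0).
Local Notation mix := (@mix R d0 k0 B).
Context (B0 : 0 < B).

(** At a point with first coordinate [y], [spike i] is [spike_coef i * exp (rate y) ^ i]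
    times a factor that does not depend on [i], see [spikeE]. *)
Definition rate : R := - (2 * p * B).
Definition spike_coef (i : nat) : R := expR (- (2 * p * B ^+ 2 * i%:R ^+ 2)).
Definition spike_sum (y : R) : R :=
  \sum_(i < k0.+1) spike_coef i * expR (rate * y) ^+ i.
Definition spike_moment (y : R) : R :=
  \sum_(i < k0.+1) (2 * B * i%:R) * (spike_coef i * expR (rate * y) ^+ i).
(** Odds of the wide component against the sum of the spikes at a critical point:
    the first critical equation reads [U (1 - y) = y + spike_moment / spike_sum]. *)
Definition odds (y : R) : R := (y + spike_moment y / spike_sum y) / (1 - y).
(** Solution [x_j] of the critical equation [odds * q_j (1 - x_j) = p x_j]. *)
Definition mode_coord (j : nat) (y : R) : R := odds y / (th ^+ j + odds y).
(** Its vanishing says that [odds y], obtained from the critical equations, is the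
    actual ratio of the wide component to the sum of the spikes at the point with
    coordinates [y] and [mode_coord j y]. *)
Definition mode_eq (y : R) : R :=
  ln (odds y ^+ 2) / 2 + (ln (spike_sum y ^+ 2) / 2 + (p / 8 + p / 2 * (1 - 2 * y)
   + \sum_(j < d0) (q j.+1 * (mode_coord j.+1 y - 1) ^+ 2
                     - p * mode_coord j.+1 y ^+ 2) / 2)).
Definition common_factor (x : 'cV[R]_d) : R :=
  expR (- (p / 2 * (x ord0 0 ^+ 2 + \sum_(j < d0) x (lift ord0 j) 0 ^+ 2))).

Local Notation b := rate.
Local Notation S := spike_sum.
Local Notation T := spike_moment.
Local Notation u := odds.
Local Notation z := mode_coord.
Local Notation Psi := mode_eq.
Local Notation G := common_factor.

Lemma rate_neq0 : b != 0.
Proof. by rewrite oppr_eq0 !mulf_neq0 ?lt0r_neq0 ?prec_gt0. Qed.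

Lemma spike_sum_ge1 y : 1 <= S y.
Proof.
rewrite /spike_sum big_ord_recl /spike_coef expr0n /= mulr0 oppr0 expR0 mul1r expr0 lerDl.
by apply: sumr_ge0 => i _; rewrite mulr_ge0 ?exprn_ge0 ?expR_ge0.
Qed.

Lemma spike_moment_ge0 y : 0 <= T y.
Proof.
apply: sumr_ge0 => i _; apply: mulr_ge0; first by rewrite mulr_ge0 // mulr_ge0 // ltW.
by rewrite mulr_ge0 ?exprn_ge0 ?expR_ge0.
Qed.

Lemma spikeE i x : spike B i x = G x * (spike_coef i * expR (b * x ord0 0) ^+ i).
Proof.
by rewrite /spike /common_factor /spike_coef -expRM_natl -!expRD; congr expR; rewrite /rate; field.
Qed.

Lemma mix_critical x (j : 'I_d) : Mode mix x ->
  wide_part x * (q j * (x j 0 - 1)) +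
  \sum_(i < k0.+1) spike B i x * (p * (x j 0 - mix_mean B (lift ord0 i) j)) = 0.
Proof.
rewrite mixE => /(@bumps_critical _ _ _ _ _ _ _ j); rewrite big_ord_recl => E.
rewrite -[RHS]E; congr (_ + _).
by apply: eq_bigr => i _; rewrite bump_spike mul1r.
Qed.

(** The [d] critical equations determine the odds and the last [d - 1] coordinates
    from the first one; the definition of the odds then gives [mode_eq]. *)
Lemma mode_param x : Mode mix x -> Psi (x ord0 0) = 0 /\
  forall j, x (lift ord0 j) 0 = z j.+1 (x ord0 0).
Proof.
move=> mx; set y := x ord0 0.
have G0 : 0 < G x by exact: expR_gt0.
have S0 : 0 < S y by have := spike_sum_ge1 y; lra.
have T0 := spike_moment_ge0 y.
have sumS : \sum_(i < k0.+1) spike B i x = G x * S y.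
  by rewrite /spike_sum big_distrr /=; apply: eq_bigr => i _; rewrite spikeE.
have p0 := @prec_gt0 R d0.
have V0 : 0 < wide_part x by rewrite mulr_gt0 ?expR_gt0.
have [U UE] : exists U, U = wide_part x / (G x * S y) by eexists.
have VE : wide_part x = U * (G x * S y) by rewrite UE divfK // mulf_neq0 ?lt0r_neq0.
have U0 : 0 < U by rewrite UE divr_gt0 // mulr_gt0.
have GS : G x * S y != 0 by rewrite mulf_neq0 ?lt0r_neq0.
have E0 : U * (1 - y) = y + T y / S y.
  have := mix_critical ord0 mx; rewrite /wide expr0 divr1 VE -/y.
  rewrite (_ : \sum_(i < k0.+1) _ = p * G x * (y * S y + T y)).
    move=> E; have : p * G x * S y * (U * (1 - y) - (y + T y / S y)) = 0.
      rewrite -[RHS]oppr0 -E; field; exact: lt0r_neq0.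
    have pGS : p * G x * S y != 0 by rewrite !mulf_neq0 ?lt0r_neq0.
    by move=> /eqP; rewrite mulf_eq0 (negbTE pGS) subr_eq0 => /eqP.
  rewrite mulrDr /spike_sum /spike_moment mulrCA !big_distrr /= -big_split /=; apply: eq_bigr => i _.
  rewrite spikeE -/y /mix_mean /=; ring.
(* For [1 <= y] the two sides of [E0] would have opposite signs. *)
have y1 : y < 1.
  rewrite ltNge; apply/negP => y1; have : 0 <= T y / S y by rewrite divr_ge0 // ltW.
  nra.
have uU : u y = U by rewrite /odds -E0 mulfK // subr_eq0 gt_eqF.
have zE j : x (lift ord0 j) 0 = z j.+1 y.
  have := mix_critical (lift ord0 j) mx; rewrite VE.
  rewrite (eq_bigr (fun i : 'I_k0.+1 => spike B i x * (p * x (lift ord0 j) 0))); last first.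
    by move=> i _; rewrite /mix_mean /= subr0.
  rewrite -big_distrl /= sumS /mode_coord uU /wide; set t := th ^+ j.+1 => E.
  have t0 : 0 < t by rewrite exprn_gt0 // ratio_gt0.
  have H : p * (G x * S y) / t * (x (lift ord0 j) 0 * (t + U) - U) = 0.
    by rewrite -[RHS]E; field; rewrite gt_eqF.
  have : x (lift ord0 j) 0 * (t + U) = U.
    have pGSt : p * (G x * S y) / t != 0 by rewrite !mulf_neq0 ?invr_neq0 ?lt0r_neq0.
    by move/eqP: H; rewrite mulf_eq0 (negbTE pGSt) subr_eq0 => /eqP.
  have tU : t + U != 0 by rewrite lt0r_neq0 ?addr_gt0.
  by move/(canRL (mulfK tU)).
split=> //.
have lnS (a : R) : 0 < a -> ln (a ^+ 2) / 2 = ln a.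
  by move=> a0; rewrite lnXn // -[ln a *+ 2]mulr_natr mulfK.
rewrite /mode_eq uU !lnS //.
under eq_bigr do rewrite -zE.
have : ln (wide_part x) = ln U + (ln (G x) + ln (S y)).
  by rewrite VE !lnM ?posrE // mulr_gt0.
rewrite lnM ?posrE ?expR_gt0 // ?weight_gt0 // /bump /weight /common_factor !expRK.
rewrite [in LHS]big_ord_recl /= /wide expr0 divr1 -/y.
rewrite -big_distrl /= big_split /= sumrN -!big_distrr /=.
lra.
Qed.

Lemma tame_spike_sum : tame b S.
Proof.
apply: tame_sum => i; apply: tameM; first exact: tame_cst.
exact/tameX/tame_exp.
Qed.

Lemma tame_spike_moment : tame b T.
Proof.
apply: tame_sum => i; apply: tameM; first exact: tame_cst.
apply: tameM; first exact: tame_cst.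
exact/tameX/tame_exp.
Qed.

Lemma tame_odds : tame b u.
Proof.
apply: tameM; last by apply/tameV/tameB; [exact: tame_cst|exact: tame_id].
exact: tameD (tame_id _) (tameM tame_spike_moment (tameV tame_spike_sum)).
Qed.

Lemma tame_mode_coord j : tame b (z j).
Proof. exact: tameM tame_odds (tameV (tameD (tame_cst _ _) tame_odds)). Qed.

Lemma odds_ge y : 1 / 2 < y < 1 -> 1 / (2 * (1 - y)) <= u y.
Proof.
move=> /andP[y2 y1].
have : 0 <= T y / S y by rewrite divr_ge0 ?spike_moment_ge0 //; have := spike_sum_ge1 y; lra.
move=> TS; rewrite /odds invfM mulrA ler_pM2r ?invr_gt0; lra.
Qed.

(** Otherwise the odds would vanish off a finite set, although they are positive on
    [(1/2, 1)]. *)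
Lemma odds_zeros : exists2 X, finite_set X & forall y, ~ X y -> u y != 0.
Proof.
have [fu|fu] := tame_zeros rate_neq0 tame_odds; last first.
  by exists [set y | u y = 0] => // y /= /eqP.
have [t t1 gap] := finite_left_gap 1 fu.
pose y := (Num.max t (1 / 2) + 1) / 2.
have tm : t <= Num.max t (1 / 2) by rewrite le_max lexx.
have m2 : 1 / 2 <= Num.max t (1 / 2) by rewrite le_max lexx orbT.
have m1 : Num.max t (1 / 2) < 1 by rewrite gt_max t1; lra.
have yb : 1 / 2 < y < 1 by rewrite /y; apply/andP; split; lra.
exfalso; apply: (gap y); first by rewrite /y; apply/andP; split; lra.
rewrite /= gt_eqF //; apply: lt_le_trans (odds_ge yb).
by rewrite divr_gt0 // mulr_gt0 // subr_gt0; case/andP: yb.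
Qed.

Lemma tame_derive_mode_eq : tame_derive b Psi.
Proof.
apply: tame_deriveD.
  have H := tame_derive_ln rate_neq0 tame_odds odds_zeros; exact: H.
apply: tame_deriveD.
  apply: (tame_derive_ln rate_neq0 tame_spike_sum); exists set0 => // y _.
  by rewrite gt_eqF //; have := spike_sum_ge1 y; lra.
apply: (tame_tame_derive rate_neq0); apply: tameD.
  apply: tameD; first exact: tame_cst.
  apply: tameM; first exact: tame_cst.
  apply: tameB; first exact: tame_cst.
  by apply: tameM; [exact: tame_cst|exact: tame_id].
apply: tame_sum => j; apply: tameM; last exact: tame_cst.
apply: tameB.
  apply: tameM; first exact: tame_cst.
  exact: tameX (tameB (tame_mode_coord _) (tame_cst _ _)).
exact: tameM (tame_cst _ _) (tameX _ (tame_mode_coord _)).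
Qed.

(** As [y] tends to 1 from the left the odds tend to infinity, while the other terms
    are bounded below because [mode_coord] stays between 0 and 1 and [spike_sum] is
    at least 1. *)
Lemma mode_eq_blowup M : exists2 t, t < 1 & forall y, t < y < 1 -> M < Psi y.
Proof.
pose C : R := M + p + d0%:R * p.
pose t := Num.max (1 / 2) (1 - expR (- C) / 2).
have e0 : 0 < expR (- C) by exact: expR_gt0.
exists t; first by rewrite gt_max; apply/andP; split; lra.
move=> y /andP[]; rewrite gt_max => /andP[y2 yC] y1.
have uy : 1 / (2 * (1 - y)) <= u y by apply: odds_ge; rewrite y2.
have uC : expR C < u y.
  apply: lt_le_trans uy; rewrite -[C]opprK expRN div1r ltf_pV2 ?posrE; lra.
have u0 : 0 < u y by apply: lt_trans uC; exact: expR_gt0.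
have lnS (a : R) : 0 < a -> ln (a ^+ 2) / 2 = ln a.
  by move=> a0; rewrite lnXn // -[ln a *+ 2]mulr_natr mulfK.
have S1 := spike_sum_ge1 y.
rewrite /mode_eq !lnS //; last by lra.
have : C < ln (u y) by rewrite -[C]expRK ltr_ln // posrE ?expR_gt0.
have : 0 <= ln (S y) by exact: ln_ge0.
have : - (d0%:R * p) <= \sum_(j < d0) (q j.+1 * (z j.+1 y - 1) ^+ 2 - p * z j.+1 y ^+ 2) / 2.
  rewrite mulr_natl -mulNrn -[X in _ *+ X]card_ord -sumr_const; apply: ler_sum => j _.
  have t0 : 0 < th ^+ j.+1 by rewrite exprn_gt0 // ratio_gt0.
  have z0 : 0 <= z j.+1 y by rewrite divr_ge0 ?addr_ge0 // ltW.
  have z1 : z j.+1 y <= 1 by rewrite ler_pdivrMr ?addr_gt0 // mul1r lerDr ltW.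
  have : 0 <= q j.+1 * (z j.+1 y - 1) ^+ 2 by rewrite mulr_ge0 ?sqr_ge0 // ltW // wide_gt0.
  have zz : z j.+1 y ^+ 2 <= 1 by rewrite expr_le1.
  have P := @prec_gt0 R d0; have := ler_wpM2l (ltW P) zz; lra.
have := @prec_gt0 R d0; rewrite /C; nra.
Qed.

Lemma finite_modes : finite_set (Mode mix).
Proof.
have fZ := finite_zeros_tame_derive rate_neq0 tame_derive_mode_eq mode_eq_blowup.
pose f (y : R) : 'cV[R]_d := \col_j (if j == 0 :> nat then y else z j y).
apply: sub_finite_set (finite_image f fZ) => x mx.
have [Py zE] := mode_param mx; exists (x ord0 0) => //.
apply/colP => j; rewrite mxE; case: (unliftP ord0 j) => [j'|] -> //=.
Qed.
End Finiteness.

(** * The lower bounds *)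

Lemma Lpp_ge d k : (1 <= d)%N -> (2 <= k)%N -> (d + k - 1 <= Lpp d k)%N.
Proof.
move=> hd hk; rewrite /Lpp (big_cat_nat _ (n := 2)) //=; last first.
  by rewrite ltnS leq_min hd /= trunc_log_max.
apply: leq_trans (leq_maxl _ _); rewrite big_nat1 divn1 modn1 subn0 expn0 muln1 !expn1.
by lia.
Qed.

(** It remains to choose [B] so large that the remote components contribute less
    than [gap] on the boundaries. *)
Lemma max_modes_ge (R : realType) (d k : nat) : (1 <= d)%N -> (2 <= k)%N ->
  (((d + k - 1)%N%:R : R)%R%:E <= max_modes R d k)%E.
Proof.
case: d k => [|d0] [|[|k0]] // _ _.
have k20 : 0 < k0.+2%:R :> R by rewrite ltr0n.
have [s s0 Hs] := expR_small (divr_gt0 (@gap_gt0 R d0) k20).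
pose B := 1 + s.
have B0 : 0 < B by rewrite addr_gt0.
have epsP : k0.+2%:R * expR (- (prec d0 / 2 * B ^+ 2)) < gap d0.
  rewrite mulrC -ltr_pdivlMr //; apply: Hs.
  have := @prec_ge48 R d0; rewrite /B; nra.
have fM := @finite_modes R d0 k0 B B0.
have [c c0 gm] := bumps_mixture (mix_mean B) (@mix_amp_gt0 R d0 k0) (@mix_prec_gt0 R d0 k0).
rewrite -mixE in gm.
apply: (@le_trans _ _ (#|` fset_set (Mode (mix k0 B : 'cV[R]_d0.+1 -> R))|%fset%:R)%:E).
  by rewrite lee_fin ler_nat; exact: many_modes.
apply: ereal_sup_ubound; exists (fun x => c * mix k0 B x); first by rewrite /= Mode_scale.
by rewrite Mode_scale.
Qed.

Theorem corollary4p6 (R : realType) (d k : nat) (hd : (1 <= d)%N)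
    (hk : (2 <= k)%N) :
  (d + k - 1 <= Lpp d k)%N /\
  (((d + k - 1)%N%:R : R)%R%:E <= max_modes R d k)%E.
Proof. by split; [exact: Lpp_ge|exact: max_modes_ge]. Qed.
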